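(* Let $p$ be an odd prime, let $k$ and $n$ be positive integers and let $d=\gcd(n,4k)$. Then $$-p^{-n/2}\left[\#B_k(\mathbb F_{p^n})-(p^n+1)\right]=\begin{cases} 0 &\text{if } d\mid k \text{ and } d \text{ is odd},\\ (-1)^{n(p-1)/4}(p-1) &\text{if } d\mid k \text{ and } d \text{ is even},\\ p-1 &\text{if } d\nmid k \text{ and } \tfrac d2\mid k,\\ (p-1)p^{\gcd(k,n)} &\text{if } d\nmid 2k \text{ and } d\mid 4k. \end{cases}$$
   Context: $B_k$ denotes the smooth projective curve over $\mathbb{F}_p$ with affine equation $y^p-y=x^{p^k+1}$. It has exactly one point at infinity, which is rational, so $\#B_k(\mathbb{F}_{p^n})$ is $1$ plus the number of solutions $(x,y)\in\mathbb{F}_{p^n}^2$ of the affine equation. *)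

(* Defs.v *)
From mathcomp Require Import all_boot all_order all_algebra.

Set Implicit Arguments.
Unset Strict Implicit.
Unset Printing Implicit Defensive.

Import GRing.Theory.
Local Open Scope ring_scope.

(* The F-rational points of the smooth projective model of                    *)
(* y^p - y = x^(p^k+1), for F a finite field of characteristic p: the affine  *)
(* solutions Some (x, y), together with None, which stands for the unique     *)
(* point at infinity (it is rational).                                        *)
Definition curveB (p k : nat) (F : finFieldType) : {set option (F * F)} :=
  [set P | if P is Some (x, y) then y ^+ p - y == x ^+ (p ^ k + 1) else true].

(* Main.v *)
(* Let q = p^n, let Tr be the trace of F over its prime field, and let N be   *)
(* the number of x with Tr (x^(p^k+1)) = 0. By Artin-Schreier #B = 1 + pN, and *)
(* p^k + 1 may be replaced by e = gcd(p^k + 1, q - 1). With g = gcd(n, k) and *)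
(* P = p^g, e is 2 if n/g is odd and P + 1 otherwise.                         *)
(* - n odd, e = 2: a nonsquare c of F_p is a nonsquare of F, and multiplying  *)
(*   by c preserves the kernel of Tr, so this kernel has as many nonzero      *)
(*   squares as nonsquares.                                                   *)
(* - n even and 4 not dividing n/g: put L = sqrt q. As e divides L + 1, the   *)
(*   map x |-> x^e + x^(eL) onto the subfield of order L has nonzero fibres   *)
(*   of equal size, and its zeros are those of x^(e(L-1)) = -1.               *)
(* - 4 divides n/g: Tr (x^(P+1)) is a quadratic form whose radical has order  *)
(*   P^2. Counting the pairs with Tr (x^(P+1)) = Tr (y^(P+1)) determines      *)
(*   #{Tr (x^(P+1)) = 0} - #{Tr (x^(P+1)) = 1} up to sign, and its residue    *)
(*   modulo P + 1 determines the sign.                                        *)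
Require Import Defs.
From mathcomp Require Import all_boot all_order all_algebra.
From mathcomp Require Import finfield zify ring.
From mathcomp Require Import reals exp.

Set Implicit Arguments.
Unset Strict Implicit.
Unset Printing Implicit Defensive.

Import Order.TTheory GRing.Theory Num.Theory.
Local Open Scope ring_scope.

(** The whole argument counts fibres and uses no character sums. Write q = p^n, g = gcd(n, k), P =
    p^g, and let N(e) be the number of x with Tr(x^e) = 0. [card_curveB] turns the point count into
    1 + p N(e) with e = gcd(p^k + 1, q - 1), so the quantity sought is -(p N(e) - q) / sqrt q.
    [gcdn_expnD1_pred] evaluates e as 2 or P + 1, and [gcdn_4mul] gives d = gcd(n/g, 4) g. The four
    cases therefore mean: n odd; n/g odd with n even; n/g twice an odd number; 4 divides n/g.

    N(e) then comes from three counts. [card_trace_square_odd] handles n odd by symmetry between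
    squares and nonsquares. [card_trace_expr_half] handles the two middle cases with e = 2 and e = P
    + 1; the sign depends on the parity of (sqrt q + 1) / e, supplied by [odd_expnD1_div2] and
    [odd_expnD1_div]. [card_trace_expr_quarter] handles the last case by a second moment, with a
    congruence modulo P + 1 fixing the sign. *)

(** * Fibres of maps between finite sets, and power maps on a finite field *)

Lemma card_preim_fibres (T U : finType) (f : T -> U) (P : pred U) :
  #|[set x | P (f x)]| = (\sum_(y | P y) #|[set x | f x == y]|)%N.
Proof.
rewrite -sum1dep_card (partition_big f P) //; apply: eq_bigr => y Py.
rewrite -sum1dep_card; apply: eq_bigl => x.
by case: eqP => [->|_]; rewrite ?Py ?andbF.
Qed.

(** An upper bound on every fibre, together with a matching lower bound on their total, forces
    equality everywhere. Fibre sizes of powers, traces and y^p - y are all obtained this way from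
    degree bounds. *)
Lemma tight_fibres (T U : finType) (f : T -> U) (D : pred U) (a : nat) :
  (forall y, D y -> #|[set x | f x == y]| <= a)%N ->
  (a * #|[set y | D y]| <= #|[set x | D (f x)]|)%N ->
  (a * #|[set y | D y]|)%N = #|[set x | D (f x)]| /\
  forall y, D y -> #|[set x | f x == y]| = a.
Proof.
move=> le_a; rewrite (card_preim_fibres f D).
have -> : (a * #|[set y | D y]| = \sum_(y | D y) a)%N.
  by rewrite sum_nat_const mulnC cardsE.
have [le_sum eq_sum] := leqif_sum (fun y Dy => leqif_eq (le_a y Dy)).
move=> ge_sum; have /eqP sumE : (\sum_(y | D y) #|[set x | f x == y]| ==
  \sum_(y | D y) a)%N by rewrite eqn_leq le_sum.
split=> // y Dy; move/eqP: sumE; rewrite eq_sum => /forall_inP allD.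
by apply/eqP/allD.
Qed.

Lemma card_roots_lt (F : finFieldType) (q : {poly F}) (A : {set F}) :
  q != 0 -> {in A, forall x, root q x} -> (#|A| < size q)%N.
Proof.
move=> q_neq0 rootA; rewrite cardE; apply: max_poly_roots => //.
  by apply/allP => x; rewrite mem_enum; apply: rootA.
exact: enum_uniq.
Qed.

Lemma card_expr_le (F : finFieldType) (a : nat) (z : F) :
  (0 < a)%N -> (#|[set x : F | x ^+ a == z]| <= a)%N.
Proof.
move=> a_gt0; rewrite -ltnS -(size_XnsubC z a_gt0); apply: card_roots_lt.
  by rewrite -size_poly_gt0 size_XnsubC.
by move=> x; rewrite inE => /eqP <-; rewrite rootE !hornerE subrr.
Qed.

Lemma expf_card_pred (F : finFieldType) (x : F) :
  x != 0 -> x ^+ #|F|.-1 = 1.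
Proof.
move=> x_neq0; apply: (mulfI x_neq0); rewrite -exprS prednK ?mulr1 ?expf_card //.
by apply/card_gt0P; exists x.
Qed.

Lemma card_finField_pred_gt0 (F : finFieldType) : (0 < #|F|.-1)%N.
Proof. by rewrite -subn1 subn_gt0 finNzRing_gt1. Qed.

(* Each fibre has at most g points, and the nonzero elements all land in the *)
(* roots of 'X^((q-1)/g) - 1; as there are q-1 of them, equality holds.      *)
Lemma card_expr_eq (F : finFieldType) (a : nat) (z : F) :
  (0 < a)%N -> z != 0 ->
  #|[set x : F | x ^+ a == z]| =
  if z ^+ (#|F|.-1 %/ gcdn a #|F|.-1) == 1 then gcdn a #|F|.-1 else 0%N.
Proof.
move=> a_gt0 z_neq0; set g := gcdn a _.
have q_gt0 := card_finField_pred_gt0 F.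
have g_gt0 : (0 < g)%N by rewrite gcdn_gt0 a_gt0.
have gq : (g %| #|F|.-1)%N by apply: dvdn_gcdr.
have gaE : (#|F|.-1 %/ g * a = a %/ g * #|F|.-1)%N.
  by rewrite -{1}(divnK (dvdn_gcdl a #|F|.-1 : g %| a)%N) mulnCA mulnA -mulnA divnK.
have powE (x : F) : x != 0 -> (x ^+ a) ^+ (#|F|.-1 %/ g) = 1.
  by move=> x_neq0; rewrite -exprM mulnC gaE mulnC exprM expf_card_pred ?expr1n.
have m_gt0 : (0 < #|F|.-1 %/ g)%N by rewrite divn_gt0 // dvdn_leq.
pose D := fun y : F => y ^+ (#|F|.-1 %/ g) == 1.
have D_neq0 y : D y -> y != 0.
  by apply: contraTneq => ->; rewrite /D expr0n (gtn_eqF m_gt0) mulr0n eq_sym oner_eq0.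
have card_D : (#|[set y | D y]| <= #|F|.-1 %/ g)%N.
  by apply: card_expr_le.
have D_pow (x : F) : D (x ^+ a) = (x != 0).
  apply/idP/idP => [/D_neq0|x_neq0]; last by apply/eqP/powE.
  by rewrite expf_eq0 a_gt0.
have card_le y : D y -> (#|[set x : F | x ^+ a == y]| <= g)%N.
  move=> Dy; have [u v uv _] := egcdnP #|F|.-1 a_gt0.
  apply: leq_trans (card_expr_le (y ^+ u) g_gt0).
  apply/subset_leq_card/subsetP => x; rewrite !inE => /eqP xy.
  have x_neq0 : x != 0 by rewrite -D_pow xy.
  rewrite -xy -exprM mulnC uv exprD mulnC exprM expf_card_pred // expr1n mul1r.
  exact: eqxx.
case: ifPn => [Dz|nDz].
  have [|_] := tight_fibres card_le; last by apply.
  apply: leq_trans (leq_mul (leqnn g) card_D) _; rewrite mulnC divnK //.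
  have -> : [set x : F | D (x ^+ a)] = [set~ 0].
    by apply/setP => x; rewrite !inE D_pow.
  by rewrite cardsC1.
apply/eqP; rewrite cards_eq0; apply/eqP/setP => x; rewrite !inE.
apply: contraNF nDz => /eqP zE; rewrite -zE; apply/eqP/powE.
by apply: contraNneq z_neq0 => x0; rewrite -zE x0 expr0n (gtn_eqF a_gt0).
Qed.

(** The two power maps have fibres of equal size over every point, since [card_expr_eq] depends on
    [a] only through the gcd. *)
Lemma card_expr_gcdn (F : finFieldType) (P : pred F) (a : nat) :
  (0 < a)%N ->
  #|[set x : F | P (x ^+ a)]| = #|[set x : F | P (x ^+ gcdn a #|F|.-1)]|.
Proof.
move=> a_gt0; rewrite !(card_preim_fibres (fun x : F => x ^+ _)).
apply: eq_bigr => z _; have g_gt0 : (0 < gcdn a #|F|.-1)%N.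
  by rewrite gcdn_gt0 a_gt0.
have [->|z_neq0] := eqVneq z 0.
  by congr #|pred_of_set _|; apply/setP => x; rewrite !inE !expf_eq0 a_gt0 g_gt0.
rewrite !card_expr_eq //.
by rewrite (gcdn_idPl (dvdn_gcdr _ _)).
Qed.

(** * The absolute trace and the Artin-Schreier equation *)

(** Values stay in [F], the prime field being the solutions of t^p = t. The length is a parameter so
    that the same sum also serves as the trace of a subfield. *)
Definition trace (F : finFieldType) (p n : nat) (z : F) : F :=
  \sum_(i < n) z ^+ (p ^ i).

Section Trace.
Variables (F : finFieldType) (p n : nat).
Hypotheses (p_prime : prime p) (n_gt0 : (0 < n)%N) (cardF : #|F| = (p ^ n)%N).

Let p_gt0 : (0 < p)%N. Proof. exact: prime_gt0. Qed.
Let p_gt1 : (1 < p)%N. Proof. exact: prime_gt1. Qed.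

Lemma exprDp i (x y : F) : (x + y) ^+ (p ^ i) = x ^+ (p ^ i) + y ^+ (p ^ i).
Proof.
apply: exprDn_pchar; rewrite (eq_pnat _ (pcharf_eq (card_finPcharP cardF p_prime))).
by rewrite pnatX pnat_id.
Qed.

Lemma exprNp i (x : F) : (- x) ^+ (p ^ i) = - x ^+ (p ^ i).
Proof.
by apply/eqP; rewrite -addr_eq0 -exprDp addNr expr0n expn_eq0 -leqn0 leqNgt p_gt0.
Qed.

Lemma expr_sum_p i (I : Type) (r : seq I) (P : pred I) (f : I -> F) :
  (\sum_(j <- r | P j) f j) ^+ (p ^ i) = \sum_(j <- r | P j) f j ^+ (p ^ i).
Proof.
elim/big_rec2: _ => [|j y x _ <-]; last exact: exprDp.
by rewrite expr0n expn_eq0 -leqn0 leqNgt p_gt0.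
Qed.

Lemma traceD m (x y : F) : trace p m (x + y) = trace p m x + trace p m y.
Proof. by rewrite -big_split /=; apply: eq_bigr => i _; apply: exprDp. Qed.

Lemma traceZ m (c x : F) : c ^+ p = c -> trace p m (c * x) = c * trace p m x.
Proof.
move=> cp; rewrite /trace big_distrr /=; apply: eq_bigr => i _; rewrite exprMn.
by congr (_ * _); elim: (val i) => // j IH; rewrite expnS exprM cp.
Qed.

Lemma traceN m (x : F) : trace p m (- x) = - trace p m x.
Proof. by rewrite /trace -sumrN; apply: eq_bigr => i _; apply: exprNp. Qed.

Lemma trace_frobenius (x : F) : trace p n (x ^+ p) = trace p n x.
Proof.
rewrite /trace; have -> : n = n.-1.+1 by rewrite prednK.
rewrite big_ord_recr big_ord_recl /= -exprM -expnS prednK // -cardF expf_card.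
rewrite addrC expr1; congr (_ + _); apply: eq_bigr => i _.
by rewrite -exprM -expnS.
Qed.

Lemma trace_frobenius_iter i (x : F) : trace p n (x ^+ (p ^ i)) = trace p n x.
Proof.
by elim: i => [|i IH]; rewrite ?expr1 // expnSr exprM trace_frobenius.
Qed.

Lemma trace_expp (x : F) : trace p n x ^+ p = trace p n x.
Proof.
rewrite -[in RHS]trace_frobenius -[X in _ ^+ X]expn1 expr_sum_p.
by apply: eq_bigr => i _; rewrite -!exprM mulnC.
Qed.

Lemma card_trace_fibre_le m (t : F) :
  (#|[set z : F | trace p m.+1 z == t]| <= p ^ m)%N.
Proof.
pose q : {poly F} := 'X^(p ^ m) + (\sum_(i < m) 'X^(p ^ i) - t%:P).
have size_q : size q = (p ^ m).+1.
  have pm_gt0 : (0 < p ^ m)%N by rewrite expn_gt0 p_gt0.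
  rewrite size_polyDl size_polyXn // ltnS.
  apply: leq_trans (size_polyD _ _) _; rewrite geq_max size_polyN.
  rewrite (leq_trans (size_polyC_leq1 _)) // andbT.
  apply: leq_trans (size_sum _ _ _) _; apply/bigmax_leqP => i _.
  by rewrite size_polyXn ltn_exp2l.
rewrite -ltnS -size_q; apply: card_roots_lt; first by rewrite -size_poly_gt0 size_q.
move=> z; rewrite inE => /eqP trz; rewrite rootE /q !hornerE horner_sum -trz.
under eq_bigr => i _ do rewrite hornerXn.
by rewrite /trace big_ord_recr /= subr_eq0 addrC.
Qed.

(** The upper bound is the degree of X^p - X. For the lower bound, the trace sends all p^n elements
    into this set with fibres of size at most p^(n-1). *)
Lemma prime_field_card : #|[set t : F | t ^+ p == t]| = p.
Proof.
apply/eqP; rewrite eqn_leq; apply/andP; split.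
  pose q : {poly F} := 'X^p - 'X.
  have size_q : size q = p.+1.
    by rewrite size_polyDl ?size_polyN ?size_polyX size_polyXn // ltnS.
  rewrite -ltnS -size_q; apply: card_roots_lt; first by rewrite -size_poly_gt0 size_q.
  by move=> x; rewrite inE => /eqP xp; rewrite rootE !hornerE xp subrr.
have pn1_gt0 : (0 < p ^ n.-1)%N by rewrite expn_gt0 p_gt0.
rewrite -(leq_pmul2r pn1_gt0) -expnS prednK // -cardF.
pose D (t : F) := t ^+ p == t.
have -> : #|F| = #|[set x : F | D (trace p n x)]|.
  by apply/esym/eqP; rewrite -cardsT; apply/eqP; congr #|pred_of_set _|;
    apply/setP => x; rewrite !inE /D trace_expp eqxx.
rewrite (card_preim_fibres (trace p n) D) -sum1dep_card big_distrl /= leq_sum // => t _.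
by rewrite mul1n -{1}(prednK n_gt0) card_trace_fibre_le.
Qed.

Lemma card_trace_fibre (t : F) :
  t ^+ p = t -> #|[set z : F | trace p n z == t]| = (p ^ n.-1)%N.
Proof.
move=> tp; have [||_] := @tight_fibres F F (trace p n)
  (fun t => t ^+ p == t) (p ^ n.-1); last by apply; apply/eqP.
- by move=> y _; rewrite -{1}(prednK n_gt0) card_trace_fibre_le.
rewrite prime_field_card -expnSr prednK // -cardF -cardsT.
by apply/subset_leq_card/subsetP => x _; rewrite inE trace_expp.
Qed.

(** Additive Hilbert 90 by counting: y^p - y lands in the trace kernel, of order p^(n-1), with
    fibres of size at most p. *)
Lemma card_artin_schreier (z : F) :
  #|[set y : F | y ^+ p - y == z]| = if trace p n z == 0 then p else 0%N.
Proof.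
have trAS (y : F) : trace p n (y ^+ p - y) = 0.
  by rewrite traceD traceN trace_frobenius subrr.
case: ifPn => [trz|trz]; last first.
  apply/eqP; rewrite cards_eq0; apply/eqP/setP => y; rewrite !inE.
  by apply: contraNF trz => /eqP <-; rewrite trAS.
have [||_] := @tight_fibres F F (fun y => y ^+ p - y)
  (fun z => trace p n z == 0) p; last exact.
- move=> y _; pose q : {poly F} := 'X^p - ('X + y%:P).
  have size_q : size q = p.+1.
    by rewrite size_polyDl ?size_polyN ?size_XaddC size_polyXn // ltnS.
  rewrite -ltnS -size_q; apply: card_roots_lt; first by rewrite -size_poly_gt0 size_q.
  by move=> x; rewrite inE => /eqP xy; rewrite rootE /q !hornerE -xy; apply/eqP; ring.
rewrite card_trace_fibre ?expr0n ?gtn_eqF // -expnS prednK // -cardF -cardsT.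
by apply/subset_leq_card/subsetP => x _; rewrite inE trAS.
Qed.

Lemma card_curveB k :
  #|curveB p k F| =
  (1 + p * #|[set x : F | trace p n (x ^+ gcdn (p ^ k + 1) #|F|.-1) == 0%R]|)%N.
Proof.
rewrite -(card_expr_gcdn (fun z => trace p n z == 0)) ?addn1 //.
pose A := [set u : F * F | u.2 ^+ p - u.2 == u.1 ^+ (p ^ k + 1)].
have -> : curveB p k F = None |: [set Some u | u in A].
  apply/setP => -[[x y]|]; rewrite !inE //=.
  by rewrite mem_imset ?inE // => ? ? [].
rewrite cardsU1 card_imset; last by move=> ? ? [].
have -> : (None : option (F * F)) \notin [set Some u | u in A].
  by apply/imsetP => -[].
congr (_ + _)%N.
rewrite -(sum1dep_card (fun u : F * F => _)).
rewrite -(pair_big_dep xpredT (fun x y => y ^+ p - y == x ^+ (p ^ k + 1))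
   (fun _ _ => 1%N)) /=.
under eq_bigr => x _ do rewrite sum1dep_card card_artin_schreier.
rewrite -big_mkcond /= sum_nat_const mulnC addn1; congr (_ * _)%N.
by rewrite cardsE.
Qed.

End Trace.

(** * Arithmetic that turns fibre counts into the final formulas *)

(** Models a map from a field of order L^2 onto its subfield of order L, with 1 + (L - 1) e points
    over 0 and f over each nonzero element; u is the number of trace-zero elements of the subfield.
    Dividing L^2 - 1 by L - 1 gives e + f = L + 1. *)
Lemma fibre_arith (p u L e f : nat) : (1 < L)%N -> (L = p * u)%N ->
  (L * L = 1 + (L - 1) * e + (L - 1) * f)%N ->
  (p * (1 + (L - 1) * e + (u - 1) * f) + (p - 1) * L = L ^ 2 + (p - 1) * e * L)%N.
Proof.
case: L => [|M] // M_gt0; rewrite subn1 /=.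
case: u => [|v]; first by rewrite muln0.
case: p => [|q] //; rewrite !subn1 /= => ME sum_ef.
have efE : (e + f = M.+2)%N.
  by apply/eqP; rewrite -(eqn_pmul2l (M_gt0 : 0 < M)%N); apply/eqP; lia.
have M_f : (M * f = q.+1 * v * f + q * f)%N.
  by rewrite -mulnDl; congr (_ * _)%N; lia.
have M_ef : (M * (e + f) = M * M.+2)%N by rewrite efE.
have q_ef : (q * (e + f) = q * M.+2)%N by rewrite efE.
lia.
Qed.

(* The hypotheses give (N0 - N1)^2 = (P L)^2; the congruences modulo P + 1    *)
(* exclude N0 - N1 = P L.                                                     *)
Lemma quarter_arith (p P L N0 N1 Q a b c : nat) :
  (1 < p)%N -> (1 < P)%N -> (N0 + (p - 1) * N1 = L * L)%N -> (p * Q = L * L)%N ->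
  (N0 ^ 2 + (p - 1) * N1 ^ 2 = P ^ 2 * (L * L) + (L * L - P ^ 2) * Q)%N ->
  (P ^ 2 <= L * L)%N -> (N0 = a * (P + 1) + 1)%N -> (N1 = b * (P + 1))%N ->
  (L = c * (P + 1) + 1)%N -> (p * N0 + (p - 1) * (P * L) = L * L)%N.
Proof.
case: p => [|p] // p_gt0 P_gt1; rewrite subn1 /= => sumE pQ sqrE P2_le N0E N1E LE.
have [d dE] : exists d, (L * L = P ^ 2 + d)%N.
  by exists (L * L - P ^ 2)%N; rewrite subnKC.
have dQE : (p.+1 * (d * Q) = d * (L * L))%N by rewrite mulnCA pQ.
rewrite [in (L * L - _)%N]dE addKn in sqrE.
have sqrZ : (N0%:Z - N1%:Z) ^+ 2 = (P%:Z * L%:Z) ^+ 2.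
  have p_neq0 : p%:Z != 0 by rewrite eqz_nat -lt0n.
  apply: (mulfI p_neq0).
  have sumZ : (N0%:Z + p%:Z * N1%:Z) ^+ 2 = (L%:Z * L%:Z) ^+ 2.
    by congr (_ ^+ 2); lia.
  have sqrZ : (p%:Z + 1) * (N0%:Z ^+ 2 + p%:Z * N1%:Z ^+ 2) =
     (p%:Z + 1) * (P%:Z ^+ 2 * (L%:Z * L%:Z) + d%:Z * Q%:Z).
    by congr (_ * _); rewrite !expr2; move: sqrE; rewrite -!mulnn; lia.
  have dZ : d%:Z = L%:Z * L%:Z - P%:Z ^+ 2 by rewrite expr2; move: dE; rewrite -mulnn; lia.
  have QZ : (p%:Z + 1) * Q%:Z = L%:Z * L%:Z by move: pQ; lia.
  (* Here [p] denotes the original prime minus 1. This is the variance identity for one value N0 and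
     [p] values N1. *)
  have -> : p%:Z * (N0%:Z - N1%:Z) ^+ 2 = (p%:Z + 1) * (N0%:Z ^+ 2 + p%:Z * N1%:Z ^+ 2)
     - (N0%:Z + p%:Z * N1%:Z) ^+ 2 by ring.
  rewrite sqrZ sumZ mulrDr [_ * (d%:Z * _)]mulrCA QZ dZ; ring.
move/eqP: sqrZ; rewrite eqf_sqr => /orP[]/eqP S_E.
  have : P%:Z - 1 = (a%:Z - b%:Z - P%:Z * c%:Z) * (P%:Z + 1).
    by rewrite N0E N1E LE in S_E; lia.
  move: (a%:Z - _ - _) => u uE; have P_ge0 : 0 <= P%:Z + 1 by rewrite addr_ge0.
  have [u_le0|u_gt0] := lerP u 0.
    by have := mulr_le0_ge0 u_le0 P_ge0; rewrite -uE; lia.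
  have : P%:Z + 1 <= u * (P%:Z + 1) by rewrite ler_peMl // -gtz0_ge1.
  by rewrite -uE; lia.
have N1S : (N1 = N0 + P * L)%N by lia.
by rewrite -sumE {}N1S; lia.
Qed.

Lemma expr_surj (F : finFieldType) (a : nat) (z : F) :
  (a %| #|F|.-1)%N -> z != 0 -> z ^+ (#|F|.-1 %/ a) = 1 ->
  exists2 w : F, w != 0 & w ^+ a = z.
Proof.
move=> a_dvd z_neq0 z1.
have a_gt0 : (0 < a)%N by apply: dvdn_gt0 a_dvd; apply: card_finField_pred_gt0.
have := card_expr_eq a_gt0 z_neq0; rewrite (gcdn_idPl a_dvd) z1 eqxx => card_a.
have /card_gt0P[w] : (0 < #|[set x : F | x ^+ a == z]|)%N by rewrite card_a.
rewrite inE => /eqP wz; exists w => //.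
by apply: contraNneq z_neq0 => w0; rewrite -wz w0 expr0n (gtn_eqF a_gt0).
Qed.

(** Over a nonzero element the fibre of x^a is empty or has exactly [a] points. *)
Lemma card_expr_dvd (F : finFieldType) (P : pred F) (a : nat) :
  (a %| #|F|.-1)%N -> ~~ P 0 -> (a %| #|[set x : F | P (x ^+ a)]|)%N.
Proof.
move=> a_dvd nP0.
have a_gt0 : (0 < a)%N by apply: dvdn_gt0 a_dvd; apply: card_finField_pred_gt0.
rewrite (card_preim_fibres (fun x : F => x ^+ a)) dvdn_sum // => z Pz.
rewrite card_expr_eq //; last by apply: contraNneq nP0 => <-.
by rewrite (gcdn_idPl a_dvd); case: ifP.
Qed.

(** * Odd characteristic: odd degree, and descent to the quadratic subfield *)

Section OddCharacteristic.
Variables (F : finFieldType) (p n : nat).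
Hypotheses (p_prime : prime p) (p_odd : odd p) (n_gt0 : (0 < n)%N).
Hypothesis cardF : #|F| = (p ^ n)%N.

Let p_gt0 : (0 < p)%N. Proof. exact: prime_gt0. Qed.
Let p_gt1 : (1 < p)%N. Proof. exact: prime_gt1. Qed.

Lemma two_neq0 : (2 : F) != 0.
Proof.
rewrite -(dvdn_pcharf (card_finPcharP cardF p_prime)) dvdn_prime2 //.
by apply: contraTneq p_odd => ->.
Qed.

Lemma opp1_neq1 : (-1 : F) != 1.
Proof. by rewrite eq_sym -subr_eq0 opprK two_neq0. Qed.

Lemma card_expr_opp1 a : (a %| #|F|.-1)%N ->
  #|[set x : F | x ^+ a == -1]| = if odd (#|F|.-1 %/ a) then 0%N else a.
Proof.
move=> a_dvd.
have a_gt0 : (0 < a)%N by apply: dvdn_gt0 a_dvd; apply: card_finField_pred_gt0.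
rewrite card_expr_eq ?oppr_eq0 ?oner_eq0 // (gcdn_idPl a_dvd) -signr_odd.
by case: odd; rewrite ?expr0 ?eqxx // expr1 (negbTE opp1_neq1).
Qed.

Lemma card_add_expr_eq0 (e L : nat) : (0 < e)%N -> (1 < L)%N ->
  #|[set x : F | x ^+ e + (x ^+ e) ^+ L == 0]| =
  #|[set x : F | x ^+ (e * L.-1) == -1]|.+1.
Proof.
move=> e_gt0 L_gt1; have eL_gt0 : (0 < e * L.-1)%N.
  by rewrite muln_gt0 e_gt0 -subn1 subn_gt0.
rewrite -[RHS]add1n.
have <- : (0 \notin [set x : F | x ^+ (e * L.-1) == -1]) = 1%N :> nat.
  by rewrite inE expr0n (gtn_eqF eL_gt0) eq_sym oppr_eq0 oner_eq0.
rewrite -cardsU1; congr #|pred_of_set _|; apply/setP => x; rewrite !inE.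
rewrite -(prednK (ltnW L_gt1)) exprS -exprM /= -[X in X + _]mulr1 -mulrDr.
by rewrite mulf_eq0 expf_eq0 e_gt0 addrC addr_eq0.
Qed.

(** X^((p-1)/2) - 1 has too few roots to kill all of F_p^*, so F_p has a nonsquare. It stays a
    nonsquare in [F] because (q-1)/2 is (p-1)/2 times a sum of n odd terms, which is odd. *)
Lemma prime_field_nonsquare : odd n ->
  exists2 c : F, c ^+ p = c & c ^+ (#|F|.-1 %/ 2) = -1.
Proof.
move=> n_odd.
have pE : p = p./2.*2.+1 by rewrite -[LHS]odd_double_half p_odd.
have half_gt0 : (0 < p./2)%N by rewrite half_gt0.
have [c /andP[c_neq0 /eqP cp] c_half] : exists2 c : F,
    (c != 0) && (c ^+ p == c) & c ^+ p./2 != 1.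
  apply/exists_inP; rewrite -[X in is_true X]negbK; apply/negP.
  rewrite negb_exists_in => /forall_inP all1.
  have : (#|[set c : F | (c != 0%R) && (c ^+ p == c)]| <= p./2)%N.
    apply: leq_trans (card_expr_le (1 : F) half_gt0).
    apply/subset_leq_card/subsetP => c; rewrite !inE => /all1.
    by rewrite negbK.
  have := prime_field_card p_prime n_gt0 cardF.
  rewrite (cardsD1 0) inE expr0n (gtn_eqF p_gt0) eqxx => pcard.
  have -> : [set c : F | (c != 0) && (c ^+ p == c)] =
    [set t : F | t ^+ p == t] :\ 0 by apply/setP => t; rewrite !inE.
  move: (#|_|) pcard => m /=; clear -pE half_gt0; lia.
exists c => //.
have cp1 : c ^+ p.-1 = 1.
  by apply: (mulfI c_neq0); rewrite -exprS prednK // cp mulr1.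
have p1E : p.-1 = (p./2 * 2)%N by rewrite muln2 {1}pE.
have half1 : c ^+ p./2 = -1.
  have : (c ^+ p./2) ^+ 2 == 1 by rewrite -exprM -p1E cp1.
  by rewrite sqrf_eq1 (negbTE c_half) => /eqP.
have -> : (#|F|.-1 %/ 2 = p./2 * \sum_(i < n) p ^ i)%N.
  rewrite cardF predn_exp p1E mulnAC mulnK //.
rewrite exprM half1 -signr_odd.
suff -> : odd (\sum_(i < n) p ^ i) = odd n by rewrite n_odd.
elim: (n) => [|m IH]; first by rewrite big_ord0.
by rewrite big_ord_recr oddD IH oddX p_odd orbT /= addbT.
Qed.

Lemma card_trace_square_odd : odd n ->
  (p * #|[set x : F | trace p n (x ^+ 2) == 0%R]| = p ^ n)%N.
Proof.
move=> /prime_field_nonsquare[c cp c1].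
have c_neq0 : c != 0.
  apply/eqP => c0; move/eqP: c1; rewrite c0 expr0n eq_sym.
  by case: (_ == 0)%N; rewrite ?mulr0n ?oppr_eq0 ?oner_eq0 // (negbTE opp1_neq1).
have q_even : (2 %| #|F|.-1)%N.
  by rewrite cardF dvdn2 -subn1 oddB ?expn_gt0 ?p_gt0 // oddX p_odd orbT.
pose fib (z : F) := #|[set x : F | x ^+ 2 == z]|.
(* For z nonzero, one of z and c z has two square roots and the other none; at z = 0 each fibre is
   the single point 0. *)
have fib2 z : (fib z + fib (c * z)%R = 2)%N.
  rewrite /fib; have [->|z_neq0] := eqVneq z 0.
    rewrite mulr0; have -> : [set x : F | x ^+ 2 == 0] = [set 0].
      by apply/setP => x; rewrite !inE expf_eq0.
    by rewrite cards1.
  rewrite !card_expr_eq ?mulf_neq0 // (gcdn_idPl q_even) exprMn c1 mulN1r.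
  have : (z ^+ (#|F|.-1 %/ 2)) ^+ 2 == 1 by rewrite -exprM divnK // expf_card_pred.
  rewrite sqrf_eq1 => /orP[] /eqP->; first by rewrite eqxx (negbTE opp1_neq1).
  by rewrite opprK eqxx (negbTE opp1_neq1).
pose T (z : F) := trace p n z == 0.
have N0E := card_preim_fibres (fun x : F => x ^+ 2) T.
have N0E' : #|[set x : F | T (x ^+ 2)]| = (\sum_(z | T z) fib (c * z)%R)%N.
  rewrite N0E (reindex_inj (mulfI c_neq0)) /=; apply: eq_bigl => z.
  by rewrite /T (traceZ _ _ cp) mulf_eq0 (negbTE c_neq0).
have : (\sum_(z | T z) (fib z + fib (c * z)%R) = 2 * p ^ n.-1)%N.
  under eq_bigr => z _ do rewrite fib2.
  rewrite sum_nat_const mulnC -(card_trace_fibre p_prime n_gt0 cardF (t := 0)).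
    by rewrite -[#|T|]cardsE.
  by rewrite expr0n (gtn_eqF p_gt0).
rewrite big_split /= -N0E' -N0E -/(T _) => /eqP.
rewrite addnn -mul2n eqn_pmul2l // => /eqP->.
by rewrite -expnS prednK.
Qed.

(* With L = sqrt q, the trace factors through x |-> x^e + x^(eL), which takes *)
(* values in the subfield of order L. Every nonzero element of that subfield  *)
(* is an e-th power, so all nonzero fibres of this map have the same size.    *)
Lemma card_trace_expr_half (l e : nat) : n = (l + l)%N -> (e %| p ^ l + 1)%N ->
  let N := #|[set x : F | trace p n (x ^+ e) == 0]| in
  if odd ((p ^ l + 1) %/ e) then (p * N + (p - 1) * p ^ l = (p ^ l) ^ 2)%N
  else (p * N = (p ^ l) ^ 2 + (p - 1) * (e - 1) * p ^ l)%N.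
Proof.
move=> nE e_dvd; set L := (p ^ l)%N in e_dvd *; move=> N.
have l_gt0 : (0 < l)%N by move: n_gt0; rewrite nE; case: (l).
have e_gt0 : (0 < e)%N by apply: dvdn_gt0 e_dvd; rewrite addn1.
have L_gt1 : (1 < L)%N by rewrite -(expn0 p) ltn_exp2l.
have qE : #|F| = (L * L)%N by rewrite cardF nE expnD.
have q1E : #|F|.-1 = (L.-1 * (L + 1))%N by rewrite qE; nia.
pose D (s : F) := s ^+ L == s.
pose g (z : F) := z + z ^+ L.
have exprLL (z : F) : (z ^+ L) ^+ L = z by rewrite -exprM -qE expf_card.
have Dg z : D (g z) by rewrite /D /g (exprDp p_prime cardF) exprLL addrC.
have allDg : [set z | D (g z)] = setT by apply/setP => z; rewrite !inE Dg.
have card_D_le : (#|[set s | D s]| <= L)%N.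
  pose r : {poly F} := 'X^L - 'X.
  have size_r : size r = L.+1.
    by rewrite size_polyDl ?size_polyN ?size_polyX size_polyXn // ltnS.
  rewrite -ltnS -size_r; apply: card_roots_lt; first by rewrite -size_poly_gt0 size_r.
  by move=> x; rewrite inE => /eqP xL; rewrite rootE !hornerE xL subrr.
(* [g] is the relative trace to the subfield [D]. Its fibres and [D] itself have at most L elements,
   and q = L * L, so both bounds are attained. *)
have [||/eqP card_D fib_g] := @tight_fibres F F g D L.
- move=> y _; pose r : {poly F} := 'X^L + ('X - y%:P).
  have size_r : size r = L.+1.
    by rewrite size_polyDl ?size_XsubC size_polyXn // ltnS.
  rewrite -ltnS -size_r; apply: card_roots_lt; first by rewrite -size_poly_gt0 size_r.
  by move=> x; rewrite inE /g => /eqP xy; rewrite rootE /r !hornerE -xy ?addrA subr_eq0 addrC.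
- by rewrite allDg cardsT qE leq_mul2l card_D_le orbT.
rewrite allDg cardsT qE eqn_pmul2l ?(ltnW L_gt1) // in card_D.
move/eqP: card_D => card_D.
have trace_g z : trace p n z = trace p l (g z).
  rewrite /trace nE big_split_ord /= -big_split /=; apply: eq_bigr => i _.
  by rewrite /g (exprDp p_prime cardF) -exprM -expnD.
pose K s := D s && (trace p l s == 0).
have K0 : K 0.
  rewrite /K /D expr0n (gtn_eqF (ltnW L_gt1)) mulr0n eqxx /trace big1 ?eqxx // => i _.
  by rewrite expr0n expn_eq0 (gtn_eqF p_gt0).
have card_K : #|[set s | K s]| = (p ^ l.-1)%N.
  have t0 : (0 : F) ^+ p = 0 by rewrite expr0n (gtn_eqF p_gt0).
  have := card_trace_fibre p_prime n_gt0 cardF t0.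
  have -> : [set z | trace p n z == 0] = [set z | K (g z)].
    by apply/setP => z; rewrite !inE /K Dg trace_g.
  rewrite (card_preim_fibres g K).
  under eq_bigr => s /andP[Ds _] do rewrite fib_g //.
  rewrite sum_nat_const -[#|K|]cardsE; have -> : n.-1 = (l.-1 + l)%N by rewrite nE; lia.
  by rewrite expnD => /eqP; rewrite eqn_pmul2r ?(ltnW L_gt1) // => /eqP.
pose h (x : F) := g (x ^+ e).
pose f := #|[set x : F | h x == 1]|; pose Z := #|[set x : F | h x == 0]|.
have fib_h s : D s && (s != 0) -> #|[set x | h x == s]| = f.
  case/andP=> /eqP Ds s_neq0.
  have sL1 : s ^+ L.-1 = 1.
    by apply: (mulfI s_neq0); rewrite -exprS prednK ?(ltnW L_gt1) // Ds mulr1.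
  have [||w w_neq0 ws] := @expr_surj F e s _ s_neq0.
  - by rewrite q1E dvdn_mull.
  - by rewrite q1E -muln_divA // exprM sL1 expr1n.
  rewrite /f -(card_preimset [set x | h x == s] (mulfI w_neq0)); congr #|pred_of_set _|.
  apply/setP => x; rewrite !inE /h /g exprMn ws exprMn Ds -mulrDr.
  by rewrite -{2}[s]mulr1 (inj_eq (mulfI s_neq0)).
have sum_h (Q : pred F) : Q 0 -> subpred Q D ->
    #|[set x | Q (h x)]| = (Z + (#|[set s | Q s]| - 1) * f)%N.
  move=> Q0 QD; rewrite (card_preim_fibres h Q) (bigD1 0) //=; congr (_ + _)%N.
  under eq_bigr => s /andP[/QD Ds s0] do rewrite fib_h ?Ds //.
  rewrite sum_nat_const; congr (_ * _)%N; rewrite (cardsD1 0) inE Q0 addKn.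
  by rewrite -cardsE; congr #|pred_of_set _|; apply/setP => s; rewrite !inE andbC.
have NE : N = (Z + (p ^ l.-1 - 1) * f)%N.
  rewrite -card_K -sum_h // => [|s /andP[]//]; congr #|pred_of_set _|.
  by apply/setP => x; rewrite !inE /K Dg trace_g.
have qZ : (L * L = Z + (L - 1) * f)%N.
  rewrite -{3}card_D -sum_h //; last by case/andP: K0.
  by rewrite -qE -cardsT; congr #|pred_of_set _|; apply/setP => x; rewrite !inE Dg.
(* Besides 0, the zeros of [h] solve x^(e(L-1)) = -1. Since (q-1) / (e(L-1)) = (L+1)/e, this is
   solvable exactly when that quotient is even. *)
have ZE : Z = (if odd ((L + 1) %/ e) then 1 else (e * L.-1).+1)%N.
  rewrite /Z card_add_expr_eq0 // card_expr_opp1.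
    have -> : (#|F|.-1 %/ (e * L.-1) = (L + 1) %/ e)%N.
      by rewrite q1E mulnC divnMr // -subn1 subn_gt0.
    by case: odd.
  by rewrite q1E mulnC dvdn_mul.
have LE : L = (p * p ^ l.-1)%N by rewrite -expnS prednK.
(* The odd quotient is the instance e' = 0, the even one e' = e. *)
have sizes e' : Z = (1 + (L - 1) * e')%N ->
  (p * N + (p - 1) * L = L ^ 2 + (p - 1) * e' * L)%N.
  by move=> Ze; rewrite NE Ze; apply: fibre_arith => //; rewrite qZ Ze.
case: ifP ZE => _ ZE; first by rewrite (sizes 0%N) ?muln0 ?mul0n ?addn0 // ZE.
have := sizes e; rewrite ZE mulnC subn1 add1n => /(_ erefl).
have -> : ((p - 1) * e * L = (p - 1) * (e - 1) * L + (p - 1) * L)%N.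
  by rewrite -mulnDl -[X in (_ + X)%N]muln1 -mulnDr subnK.
by rewrite addnA => /addIn.
Qed.

Lemma frobenius_inj i : injective (fun x : F => x ^+ (p ^ i)).
Proof.
move=> x y /= /eqP; rewrite -subr_eq0 -(exprNp p_prime cardF) -(exprDp p_prime cardF).
by rewrite expf_eq0 subr_eq0 => /andP[_ /eqP].
Qed.

(** * The case 4 | n/g: second moment of the form Tr(x^(P+1)) *)

Section QuarterExtension.
Variables (g m : nat).
Hypothesis nE : n = (g * (4 * m))%N.

Let P := (p ^ g)%N.
Let L := (p ^ (g * (2 * m)))%N.
Let N (t : F) := #|[set x : F | trace p n (x ^+ (P + 1)) == t]|.

Let g_gt0 : (0 < g)%N.
Proof. by move: n_gt0; rewrite nE muln_gt0 => /andP[]. Qed.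

Let P_gt1 : (1 < P)%N. Proof. by rewrite -(expn0 p) ltn_exp2l. Qed.

Let qE : #|F| = (L * L)%N.
Proof. by rewrite cardF nE -expnD; congr (_ ^ _)%N; lia. Qed.

Let q_pred : exists r, #|F|.-1 = ((P + 1) * (P - 1) * (P ^ 2 + 1) * r)%N.
Proof.
have /dvdnP[r rE] : ((P ^ 4).-1 %| #|F|.-1)%N.
  by rewrite cardF nE mulnA mulnC mulnC expnM expnM dvdn_pred_predX.
by exists r; rewrite rE mulnC; congr (_ * _)%N; nia.
Qed.

(** Since p - 1 divides (q-1)/(P+1), each t in F_p^* is w^(P+1) for some w in [F]; multiplication by
    w matches the two sets. *)
Lemma card_trace_quarter_scale (t : F) : t != 0 -> t ^+ p = t -> N t = N 1.
Proof.
move=> t_neq0 tp; have [r rE] := q_pred.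
have tp1 : t ^+ p.-1 = 1.
  by apply: (mulfI t_neq0); rewrite -exprS prednK // tp mulr1.
have P1_gt0 : (0 < P + 1)%N by rewrite addn1.
have [||w w_neq0 wt] := @expr_surj F (P + 1) t _ t_neq0.
- by rewrite rE -!mulnA dvdn_mulr.
- rewrite rE -!mulnA mulKn // exprM subn1.
  have /dvdnP[s ->] : (p.-1 %| P.-1)%N by apply: dvdn_pred_predX.
  by rewrite (mulnC s) [t ^+ _]exprM tp1 !expr1n.
rewrite /N -(card_preimset [set x | trace p n (x ^+ (P + 1)) == t] (mulfI w_neq0)).
congr #|pred_of_set _|; apply/setP => x; rewrite !inE exprMn wt.
rewrite (traceZ _ _ tp) -{2}[t]mulr1.
by rewrite (inj_eq (mulfI t_neq0)).
Qed.

Let sum_prime_field (f : nat -> nat) :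
  (\sum_(t : F | t ^+ p == t) f (N t) = f (N 0%R) + (p - 1) * f (N 1%R))%N.
Proof.
have F0 : (0 : F) ^+ p == 0 by rewrite expr0n (gtn_eqF p_gt0) mulr0n.
rewrite (bigD1 0) //=; congr (_ + _)%N.
under eq_bigr => t /andP[/eqP tp t0] do rewrite (card_trace_quarter_scale t0 tp).
rewrite sum_nat_const; congr (_ * _)%N.
have := prime_field_card p_prime n_gt0 cardF.
rewrite (cardsD1 0) inE F0 add1n => /(congr1 predn) /= pE.
by rewrite subn1 -pE -cardsE; congr #|pred_of_set _|; apply/setP => s; rewrite !inE andbC.
Qed.

Lemma card_trace_quarter_sum : #|F| = (N 0%R + (p - 1) * N 1%R)%N.
Proof.
rewrite -(sum_prime_field id).
rewrite -(card_preim_fibres (fun x => trace p n (x ^+ (P + 1))) (fun t => t ^+ p == t)).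
by rewrite -cardsT; congr #|pred_of_set _|; apply/setP => x;
  rewrite !inE trace_expp ?eqxx.
Qed.

(* The pairs (x, y) = (v + u, v - u) with equal traces of x^(P+1) and y^(P+1) *)
(* are those with Tr (v^P (u + u^(P^2))) = 0.                                 *)
Lemma card_trace_quarter_sqr :
  (N 0%R ^ 2 + (p - 1) * N 1%R ^ 2 = P ^ 2 * #|F| + (#|F| - P ^ 2) * p ^ n.-1)%N.
Proof.
pose tr (x : F) := trace p n (x ^+ (P + 1)).
rewrite -(sum_prime_field (fun a => a ^ 2)%N).
pose w (u : F) := u + u ^+ (P * P).
have -> : (\sum_(t : F | t ^+ p == t) N t ^ 2 =
    \sum_(x : F) \sum_(y | tr x == tr y) 1)%N.
  rewrite [RHS](partition_big tr (fun t => t ^+ p == t)) /=; last first.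
    by move=> x _; rewrite /tr trace_expp.
  apply: eq_bigr => t _; rewrite -mulnn {1}/N -sum1dep_card big_distrl /=.
  apply: eq_bigr => x /eqP <-; rewrite mul1n sum1dep_card /N.
  by congr #|pred_of_set _|; apply/setP => y; rewrite !inE eq_sym.
rewrite (pair_big_dep xpredT (fun x y => tr x == tr y) (fun _ _ => 1%N)) /=.
pose phi (a : F * F) := (a.2 + a.1, a.2 - a.1).
have phi_inj : injective phi.
  move=> [u v] [u' v'] [] /= e1 e2; congr (_, _); apply: (mulfI two_neq0).
    have -> : 2 * u = (v + u) - (v - u) by ring.
    by rewrite e1 e2; ring.
  have -> : 2 * v = (v + u) + (v - u) by ring.
  by rewrite e1 e2; ring.
rewrite (reindex_inj phi_inj) /=.
have trE (u v : F) : (tr (v + u) == tr (v - u)) = (trace p n (v ^+ P * w u) == 0).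
  (* Applying the P-power Frobenius inside the trace moves the twist onto v, so both cross terms
     share the factor v^P. *)
  have trU : trace p n (u ^+ P * v) = trace p n (v ^+ P * u ^+ (P * P)).
    rewrite -(trace_frobenius_iter n_gt0 cardF g) exprMn -exprM.
    by rewrite -/P mulrC.
  have trD := traceD p_prime cardF n; have trN := traceN p_prime cardF n.
  have -> : trace p n (v ^+ P * w u) = trace p n (v ^+ P * u) + trace p n (u ^+ P * v).
    by rewrite trU -trD -mulrDr.
  have -> : (tr (v + u) == tr (v - u)) =
      (trace p n ((v + u) ^+ (P + 1) - (v - u) ^+ (P + 1)) == 0).
    by rewrite trD trN subr_eq0.
  have -> : (v + u) ^+ (P + 1) - (v - u) ^+ (P + 1) =
      (v ^+ P * u + u ^+ P * v) + (v ^+ P * u + u ^+ P * v).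
    rewrite !addn1 !exprSr (exprDp p_prime cardF) (exprDp p_prime cardF).
    by rewrite (exprNp p_prime cardF) -/P; ring.
  by rewrite trD -[X in X + X]mul1r -mulrDl mulf_eq0 (negbTE two_neq0) trD.
under eq_bigl => a do rewrite trE.
rewrite -(pair_big_dep xpredT (fun u v => trace p n (v ^+ P * w u) == 0)
  (fun _ _ => 1%N)) /=.
(* For fixed u, the map v |-> v^P w(u) permutes [F] unless w(u) = 0, when every v qualifies. *)
have inner (u : F) : (\sum_(v : F | trace p n (v ^+ P * w u)%R == 0%R) 1 =
    if w u == 0%R then #|F| else p ^ n.-1)%N.
  rewrite sum1dep_card; have tr0 : trace p n (0 : F) = 0.
    by rewrite /trace big1 // => i _; rewrite expr0n expn_eq0 (gtn_eqF p_gt0).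
  case: eqP => [->|/eqP wu].
    by rewrite -cardsT; congr #|pred_of_set _|; apply/setP => v; rewrite !inE mulr0 tr0 eqxx.
  have inj : injective (fun v : F => v ^+ P * w u).
    by apply: (inj_comp (mulIf wu) (@frobenius_inj g)).
  rewrite -(card_trace_fibre p_prime n_gt0 cardF (t := 0)); last first.
    by rewrite expr0n (gtn_eqF p_gt0).
  rewrite -(card_preimset [set z | trace p n z == 0] inj).
  by congr #|pred_of_set _|; apply/setP => v; rewrite !inE.
under eq_bigr => u _ do rewrite inner.
have PP_gt1 : (1 < P * P)%N by nia.
have [r rE] := q_pred.
have PP1 : (P * P).-1 = ((P + 1) * (P - 1))%N by nia.
have PP1_gt0 : (0 < (P * P).-1)%N by rewrite -subn1 subn_gt0.
(* The radical consists of 0 and the solutions of x^(P^2-1) = -1. There are P^2 - 1 of these because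
   (q-1)/(P^2-1) is a multiple of the even number P^2 + 1. *)
have card_w : #|[set u | w u == 0]| = (P ^ 2)%N.
  have := card_add_expr_eq0 (isT : 0 < 1)%N PP_gt1.
  rewrite mul1n card_expr_opp1 rE -PP1 -?mulnA ?dvdn_mulr // mulKn //.
  have P_odd : odd P by rewrite oddX p_odd orbT.
  rewrite oddM oddD oddX P_odd /= => card_w.
  by rewrite -mulnn -(prednK (ltnW PP_gt1)) -card_w; congr #|pred_of_set _|.
rewrite (bigID (fun u => w u == 0)) /=.
under eq_bigr => u -> do [].
under [X in (_ + X)%N]eq_bigr => u /negbTE-> do [].
rewrite !sum_nat_const -card_w; congr (_ * _ + _ * _)%N.
  by rewrite cardsE.
by rewrite -(cardsC [set u | w u == 0]) addKn -cardsE; congr #|pred_of_set _|;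
  apply/setP => u; rewrite !inE.
Qed.

Lemma card_trace_expr_quarter : (p * N 0%R + (p - 1) * (P * L) = #|F|)%N.
Proof.
have [r rE] := q_pred.
have P1_dvd : (P + 1 %| #|F|.-1)%N by rewrite rE -!mulnA dvdn_mulr.
have /dvdnP[b N1E] : (P + 1 %| N 1%R)%N.
  apply: (@card_expr_dvd F (fun z => trace p n z == 1)) => //.
  rewrite /trace big1 1?eq_sym ?oner_eq0 // => i _.
  by rewrite expr0n expn_eq0 (gtn_eqF p_gt0).
(* The extra 1 is x = 0, the only point outside the fibres of size P + 1. *)
have [a N0E] : exists a, N 0 = (a * (P + 1) + 1)%N.
  have /dvdnP[a aE] : (P + 1 %| #|[set x : F |
      (x ^+ (P + 1) != 0%R) && (trace p n (x ^+ (P + 1)) == 0%R)]|)%N.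
    by apply: (@card_expr_dvd F (fun z => (z != 0) && (trace p n z == 0)));
      rewrite ?eqxx.
  exists a; rewrite -aE /N (cardsD1 0) inE addnC.
  have -> : trace p n ((0 : F) ^+ (P + 1)) == 0.
    rewrite /trace big1 // => i _.
    by rewrite -exprM expr0n muln_eq0 expn_eq0 addn1 (gtn_eqF p_gt0).
  by congr (_ + _)%N; apply: eq_card => x; rewrite !inE expf_eq0 addn1.
have LE : exists c, L = (c * (P + 1) + 1)%N.
  have /dvdnP[c cE] : ((P ^ 2).-1 %| L.-1)%N.
    by rewrite /L mulnA expnM expnM dvdn_pred_predX.
  exists (c * (P - 1))%N; rewrite -mulnA; have L_gt0 : (0 < L)%N by rewrite expn_gt0 p_gt0.
  have <- : ((P ^ 2).-1 = (P - 1) * (P + 1))%N by rewrite -subn_sqr exp1n subn1.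
  by rewrite -(prednK L_gt0) cE addn1.
have [c {}LE] := LE.
have sumE := card_trace_quarter_sum; have sqrE := card_trace_quarter_sqr.
have pqE : (p * p ^ n.-1 = #|F|)%N by rewrite -expnS prednK.
have P2_le : (P ^ 2 <= #|F|)%N.
  have m_gt0 : (0 < m)%N by move: n_gt0; rewrite nE !muln_gt0 => /and3P[].
  by rewrite cardF nE -expnM leq_exp2l // leq_mul2l (leq_trans _ (leq_pmulr 4 m_gt0)) ?orbT.
rewrite qE in sumE sqrE pqE P2_le *.
exact: (quarter_arith p_gt1 P_gt1 (esym sumE) pqE sqrE P2_le N0E N1E LE).
Qed.

End QuarterExtension.

End OddCharacteristic.

(** * Gcds and parities of the exponents *)

Lemma expn_gcdn_mod (x a b e : nat) : (0 < a)%N ->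
  x ^ a = 1 %[mod e] -> x ^ b = 1 %[mod e] -> x ^ gcdn a b = 1 %[mod e].
Proof.
move=> a_gt0 xa xb; have [u v uv _] := egcdnP b a_gt0.
have pow1 y c : x ^ y = 1 %[mod e] -> x ^ (c * y) = 1 %[mod e].
  by move=> xy; rewrite mulnC expnM -modnXm xy modnXm exp1n.
rewrite -(pow1 a u xa) uv expnD -modnMml (pow1 b v xb) modnMml mul1n.
by [].
Qed.

(** Put n = n' g and k = k' g with n', k' coprime, and let e be the gcd. Modulo e the order of P
    divides both 2k' and n', hence 1 or 2. If n' is odd, P = 1 and P^k' = -1 force e | 2; if n' is
    even, k' is odd and P^k' = P forces e | P + 1. *)
Lemma gcdn_expnD1_pred (p k n : nat) : odd p -> (0 < k)%N -> (0 < n)%N ->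
  gcdn (p ^ k + 1) (p ^ n).-1 =
  if odd (n %/ gcdn n k) then 2 else (p ^ gcdn n k + 1)%N.
Proof.
move=> p_odd k_gt0 n_gt0; set g := gcdn n k.
have g_gt0 : (0 < g)%N by rewrite gcdn_gt0 n_gt0.
have [k' kE] : exists k', k = (k' * g)%N by apply/dvdnP/dvdn_gcdr.
have [n' nE] : exists n', n = (n' * g)%N by apply/dvdnP/dvdn_gcdl.
have co_nk : coprime n' k'.
  by rewrite /coprime -(eqn_pmul2r g_gt0) muln_gcdl -nE -kE mul1n.
have k'_gt0 : (0 < k')%N by move: k_gt0; rewrite kE muln_gt0 => /andP[].
have -> : (n %/ g = n')%N by rewrite nE mulnK.
rewrite kE nE ![(_ * g)%N]mulnC !expnM.
set P := (p ^ g)%N; have P_odd : odd P by rewrite oddX p_odd orbT.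
have P_gt0 : (0 < P)%N by apply: odd_gt0.
have Ppow i : (0 < P ^ i)%N by rewrite expn_gt0 P_gt0.
set e := gcdn _ _.
have Pk : P ^ k' + 1 = 0 %[mod e] by rewrite mod0n; apply/eqP/dvdn_gcdl.
have Pn : P ^ n' = 1 %[mod e].
  by apply/eqP; rewrite (eqn_mod_dvd _ (Ppow _)) subn1 dvdn_gcdr.
have P2k : P ^ (2 * k') = 1 %[mod e].
  apply/eqP; rewrite (eqn_mod_dvd _ (Ppow _)) mulnC expnM.
  by rewrite -[X in (_ - X)%N](exp1n 2) subn_sqr dvdn_mull // dvdn_gcdl.
have gt0 : (0 < 2 * k')%N by rewrite muln_gt0.
have := expn_gcdn_mod gt0 P2k Pn; case: ifP => n'_odd.
  have -> : gcdn (2 * k') n' = 1%N.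
    by apply/eqP; rewrite -/(coprime _ _) coprimeMl coprime2n n'_odd coprime_sym.
  move=> P1; apply/eqP; rewrite eqn_dvd; apply/andP; split.
    have Pk1 : P ^ k' = 1 %[mod e] by rewrite -modnXm -(expn1 P) P1 modnXm exp1n.
    by move: Pk; rewrite -modnDml Pk1 modnDml mod0n => /eqP.
  rewrite dvdn_gcd !dvdn2 addn1 -subn1 (oddB (Ppow _)) /= oddX P_odd orbT oddX P_odd orbT.
  by [].
have [n'' n'E] : exists n'', n' = (2 * n'')%N.
  by exists n'./2; rewrite mul2n -[LHS]odd_double_half n'_odd.
have k'_odd : odd k' by move: co_nk; rewrite n'E coprimeMl coprime2n => /andP[].
have -> : gcdn (2 * k') n' = 2.
  rewrite n'E -muln_gcdr; move: co_nk; rewrite n'E coprimeMl => /andP[_].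
  by rewrite coprime_sym => /eqP ->.
move=> P2; apply/eqP; rewrite eqn_dvd; apply/andP; split.
  have Pk1 : P ^ k' = P %[mod e].
    rewrite -[k']odd_double_half k'_odd -mul2n expnD expn1 expnM.
    by rewrite -modnMmr -modnXm P2 modnXm exp1n modnMmr muln1.
  by move: Pk; rewrite -modnDml Pk1 modnDml mod0n => /eqP.
have P2' : P ^ 2 = 1 %[mod P + 1].
  apply/eqP; rewrite (eqn_mod_dvd _ (Ppow _)).
  by rewrite -[X in (_ - X)%N](exp1n 2) subn_sqr dvdn_mull.
rewrite dvdn_gcd; apply/andP; split.
  rewrite /dvdn -[k']odd_double_half k'_odd -mul2n expnD expn1 expnM.
  by rewrite -modnDml -modnMmr -modnXm P2' modnXm exp1n modnMmr muln1 modnDml modnn.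
rewrite -subn1 -(eqn_mod_dvd _ (Ppow _)) n'E expnM.
by rewrite -modnXm P2' modnXm exp1n.
Qed.

(** Writing (2h+1)^l = 2x + 1, the binomial expansion modulo 4 gives x congruent to l h modulo 2,
    and the quotient is x + 1. *)
Lemma odd_expnD1_div2 (h l : nat) :
  (2 %| h.*2.+1 ^ l + 1)%N /\ odd ((h.*2.+1 ^ l + 1) %/ 2) = ~~ odd (l * h).
Proof.
suff [x [xE x_odd]] : exists x, (h.*2.+1 ^ l = x.*2.+1)%N /\ odd x = odd (l * h).
  have -> : (h.*2.+1 ^ l + 1 = x.+1 * 2)%N by rewrite xE; lia.
  by rewrite dvdn_mull // mulnK //= x_odd.
elim: l => [|l [x [xE x_odd]]]; first by exists 0%N.
exists ((h * x).*2 + h + x)%N; split; first by rewrite expnS xE; lia.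
by rewrite mulSn !oddD odd_double x_odd.
Qed.

(** The quotient is an alternating sum of m odd powers. The induction uses P^(m+2) + 1 = P^2 (P^m +
    1) - (P^2 - 1). *)
Lemma odd_expnD1_div (P m : nat) : odd P -> odd m ->
  (P + 1 %| P ^ m + 1)%N /\ odd ((P ^ m + 1) %/ (P + 1)).
Proof.
move=> P_odd m_odd; have P_gt0 := odd_gt0 P_odd.
suff [s s_odd sE] : exists2 s, odd s & (P ^ (m./2.*2.+1) + 1 = s * (P + 1))%N.
  have -> : m = m./2.*2.+1 by rewrite -[LHS]odd_double_half m_odd.
  by rewrite sE dvdn_mull // mulnK // addn1.
elim: m./2 => [|j [s s_odd sE]]; first by exists 1%N; rewrite // expn1 mul1n.
have s_gt0 := odd_gt0 s_odd.
exists (P ^ 2 * s - (P - 1))%N.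
  rewrite oddB; last by apply: leq_trans (leq_pmulr _ s_gt0); nia.
  by rewrite oddM oddX P_odd s_odd oddB // P_odd.
have PE : ((P - 1) * (P + 1) = P ^ 2 - 1)%N by rewrite -subn_sqr exp1n.
have -> : (P ^ (j.+1.*2.+1) = P ^ 2 * P ^ (j.*2.+1))%N by rewrite -expnD.
rewrite mulnBl PE -mulnA -sE mulnDr muln1.
have : (0 < P ^ 2)%N by rewrite expn_gt0 P_gt0.
lia.
Qed.

Lemma gcdn_4mul (n k : nat) : (0 < n)%N ->
  gcdn n (4 * k) = (gcdn (n %/ gcdn n k) 4 * gcdn n k)%N.
Proof.
move=> n_gt0; set g := gcdn n k.
have g_gt0 : (0 < g)%N by rewrite gcdn_gt0 n_gt0.
have [k' kE] : exists k', k = (k' * g)%N by apply/dvdnP/dvdn_gcdr.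
have [n' nE] : exists n', n = (n' * g)%N by apply/dvdnP/dvdn_gcdl.
have co_nk : coprime n' k'.
  by rewrite /coprime -(eqn_pmul2r g_gt0) muln_gcdl -nE -kE mul1n.
have -> : (n %/ g = n')%N by rewrite nE mulnK.
by rewrite kE nE mulnA -muln_gcdl Gauss_gcdl.
Qed.

(* F ranges over the fields with p^n elements. The divisions d %/ 2 and       *)
(* (n * (p - 1)) %/ 4 are exact in the cases where they are used.             *)
Theorem theorem16 (R : realType) (p k n : nat) (F : finFieldType)
    (p_prime : prime p) (p_odd : odd p) (k_gt0 : (0 < k)%N) (n_gt0 : (0 < n)%N)
    (cardF : #|F| = (p ^ n)%N) :
  let d := gcdn n (4 * k) in
  let c : R :=
    - (p%:R `^ (- (n%:R / 2))) * (#|curveB p k F|%:R - (p%:R ^+ n + 1)) in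
  [/\ (d %| k)%N -> odd d -> c = 0,
      (d %| k)%N -> ~~ odd d ->
        c = (-1) ^+ ((n * (p - 1)) %/ 4) * (p%:R - 1),
      ~~ (d %| k)%N -> (d %/ 2 %| k)%N -> c = p%:R - 1
    & ~~ (d %| 2 * k)%N -> (d %| 4 * k)%N ->
        c = (p%:R - 1) * p%:R ^+ gcdn k n].
Proof.
move=> d c; set g := gcdn n k.
have p_gt0 := prime_gt0 p_prime; have p_gt1 := prime_gt1 p_prime.
have g_gt0 : (0 < g)%N by rewrite gcdn_gt0 n_gt0.
have n'E : (n = (n %/ g) * g)%N by rewrite divnK ?dvdn_gcdl.
have g_k : (g %| k)%N by apply: dvdn_gcdr.
have dE : d = (gcdn (n %/ g) 4 * g)%N by apply: gcdn_4mul.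
set n' := (n %/ g)%N in n'E dE.
have n'_gt0 : (0 < n')%N by move: n_gt0; rewrite {1}n'E muln_gt0 => /andP[].
(* For n' even, 2g divides n; were it also to divide k, it would divide g. *)
have two_g : ~~ odd n' -> ~~ (2 * g %| k)%N.
  move=> n'_even; apply/negP => gk.
  have : (2 * g %| g)%N by rewrite {2}/g dvdn_gcd gk n'E dvdn_mul // dvdn2 n'_even.
  by rewrite -{2}[g]mul1n dvdn_pmul2r.
have gcd4 : gcdn n' 4 = if odd n' then 1%N else if (4 %| n')%N then 4 else 2.
  have /gcdn_idPr := dvdnn 4.
  have : (gcdn n' 4 \in divisors 4) by rewrite -dvdn_divisors ?dvdn_gcdr.
  have : (2 %| gcdn n' 4)%N = ~~ odd n' by rewrite dvdn_gcd andbT dvdn2.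
  have : (4 %| gcdn n' 4)%N = (4 %| n')%N by rewrite dvdn_gcd andbT.
  by case: (4 %| n')%N; case: (odd n'); rewrite !inE => h4 h2 /or3P[] /eqP gE;
    move: h2 h4; rewrite gE.
pose N e := #|[set x : F | trace p n (x ^+ e) == 0]|.
have curveE : #|curveB p k F| = (1 + p * N (if odd n' then 2 else (p ^ g + 1)))%N.
  rewrite (card_curveB p_prime n_gt0 cardF) cardF gcdn_expnD1_pred //.
have p_neq0 : (p%:R : R) != 0 by rewrite pnatr_eq0 -lt0n.
(* Here l = n/2, so the real power p^(-n/2) becomes the inverse of a natural power. *)
have cE l M : n = (l + l)%N -> #|curveB p k F| = (1 + M)%N ->
    c = - (p%:R ^+ l)^-1 * (M%:R - p%:R ^+ l * p%:R ^+ l).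
  move=> nE BE; rewrite /c BE natrD nE powRN addnn -muln2.
  rewrite natrM mulfK ?pnatr_eq0 // powR_mulrn ?ler0n // muln2 -addnn exprD.
  by congr (_ * _); ring.
have cN l M X : n = (l + l)%N -> #|curveB p k F| = (1 + M)%N ->
    (M + X * p ^ l = (p ^ l) ^ 2)%N -> c = X%:R.
  move=> nE BE /(congr1 (fun a => a%:R : R)); rewrite natrD natrM !natrX => ME.
  have pl_neq0 : (p%:R : R) ^+ l != 0 by rewrite expf_neq0.
  rewrite (cE l M nE BE); have -> : M%:R = (p%:R ^+ l) ^+ 2 - X%:R * p%:R ^+ l :> R.
    by rewrite -ME addrK.
  by field.
have cP l M X : n = (l + l)%N -> #|curveB p k F| = (1 + M)%N ->
    (M = (p ^ l) ^ 2 + X * p ^ l)%N -> c = - X%:R.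
  move=> nE BE /(congr1 (fun a => a%:R : R)); rewrite natrD natrM !natrX => ME.
  have pl_neq0 : (p%:R : R) ^+ l != 0 by rewrite expf_neq0.
  by rewrite (cE l M nE BE) ME; field.
have pB1 : (p - 1)%:R = p%:R - 1 :> R by rewrite natrB.
split.
- move=> _; rewrite dE gcd4 => d_odd.
  have n'_odd : odd n' by move: d_odd; case: (odd n') => //; case: ifP; rewrite oddM.
  have n_odd : odd n by move: d_odd; rewrite n'_odd mul1n n'E oddM n'_odd.
  rewrite /c curveE n'_odd (card_trace_square_odd p_prime p_odd n_gt0 cardF n_odd).
  by rewrite natrD natrX [1 + _]addrC subrr mulr0.
- move=> d_k d_even.
  have n'_odd : odd n'.
    apply: contraTT d_k => n'_even; apply: contra (two_g n'_even); apply: dvdn_trans.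
    by rewrite dE gcd4 (negbTE n'_even) dvdn_mul //; case: ifP.
  rewrite n'_odd in curveE.
  have n_even : ~~ odd n by move: d_even; rewrite dE gcd4 n'_odd mul1n n'E oddM n'_odd.
  have nE : n = (n./2 + n./2)%N by rewrite addnn -[LHS]odd_double_half (negbTE n_even).
  have pE : p = p./2.*2.+1 by rewrite -[LHS]odd_double_half p_odd.
  have [dvd2 oddE] := odd_expnD1_div2 p./2 n./2; rewrite -pE in dvd2 oddE.
  have := card_trace_expr_half p_prime p_odd n_gt0 cardF nE dvd2.
  rewrite /= oddE -/(N 2).
  (* With n = 2l and p = 2h + 1 the exponent of the sign is l h, whose parity decides that of (p^l +
     1)/2. *)
  have -> : ((n * (p - 1)) %/ 4 = n./2 * p./2)%N.
    have -> : (p - 1 = p./2 * 2)%N by rewrite {1}pE subn1 muln2.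
    by rewrite {1}nE addnn -muln2 mulnACA mulnK.
  rewrite -signr_odd; case: odd => /=.
    by rewrite (_ : 2 - 1 = 1)%N // muln1 => /(cP _ _ _ nE curveE) ->; rewrite pB1 expr1 mulN1r.
  by move/(cN _ _ _ nE curveE) => ->; rewrite pB1 expr0 mul1r.
- rewrite dE gcd4 => d_k d2_k.
  have n'_even : ~~ odd n' by apply: contra d_k => ->; rewrite mul1n.
  (* If 4 divided n', then d/2 would be 2g, which does not divide k. *)
  have n'4 : ~~ (4 %| n')%N.
    apply: contra (two_g n'_even) => n'4; move: d2_k.
    have gE : (4 * g = 2 * g * 2)%N by rewrite mulnAC.
    by rewrite n'4 (negbTE n'_even) gE mulnK.
  have n'2 : n' = (2 * n'./2)%N by rewrite mul2n -[LHS]odd_double_half (negbTE n'_even).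
  have m_odd : odd n'./2.
    by apply: contraR n'4; rewrite {2}n'2 -dvdn2 -[4%N]/(2 * 2)%N dvdn_pmul2l.
  rewrite (negbTE n'_even) in curveE.
  have nE : n = (g * n'./2 + g * n'./2)%N by rewrite n'E {1}n'2; lia.
  have P_odd : odd (p ^ g) by rewrite oddX p_odd orbT.
  have [e_dvd oddE] := odd_expnD1_div P_odd m_odd; rewrite -expnM in e_dvd oddE.
  have := card_trace_expr_half p_prime p_odd n_gt0 cardF nE e_dvd.
  by rewrite /= oddE => /(cN _ _ _ nE curveE) ->; rewrite pB1.
move=> d_2k _.
have n'_even : ~~ odd n'.
  apply: contra d_2k => n'_odd; rewrite dE gcd4 n'_odd mul1n.
  by rewrite dvdn_mull.
have n'4 : (4 %| n')%N.
  apply: contraR d_2k => n'4; rewrite dE gcd4 (negbTE n'_even) (negbTE n'4).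
  by rewrite dvdn_mul.
have [m mE] : exists m, n' = (m * 4)%N by apply/dvdnP.
have nE : n = (g * (4 * m))%N by rewrite n'E mE; lia.
have nE2 : n = (g * (2 * m) + g * (2 * m))%N by rewrite nE; lia.
rewrite (negbTE n'_even) in curveE.
have := card_trace_expr_quarter p_prime p_odd n_gt0 cardF nE.
rewrite cardF {2}nE2 expnD mulnn mulnA => /(cN _ _ _ nE2 curveE) ->.
by rewrite natrM pB1 natrX gcdnC.
Qed.
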